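(* For all Noetherian spaces $X$ and $Y$, $\mathrm{sob}(X +_{\mathrm{lex}} Y) = \mathrm{sob}\, X + \mathrm{sob}\, Y$.
   Context: A topological space is Noetherian if every open subset is compact (every open cover has a finite subcover; no separation is required). The lexicographic sum $X +_{\mathrm{lex}} Y$ of two topological spaces is the disjoint union of $X$ and $Y$, whose open subsets are the open subsets of $Y$, plus the sets of the form $U + Y$ (disjoint union of $U$ and $Y$), where $U$ is an open subset of $X$. It is Noetherian when $X$ and $Y$ are. On the right-hand side of the claim, $+$ is ordinary ordinal addition. For a well-founded poset $P$ and $x \in P$, $\mathrm{rk}_P(x) = \sup_{x' < x} (\mathrm{rk}_P(x')+1)$ and the ordinal rank of $P$ is $|P| = \sup_{x \in P} (\mathrm{rk}_P(x)+1)$, where $\sup\emptyset = 0$. A closed subset $C$ of $X$ is irreducible if it is non-empty and, whenever $C \subseteq F_1 \cup F_2$ with $F_1, F_2$ closed in $X$, we have $C \subseteq F_1$ or $C \subseteq F_2$. $\mathcal{S} X$ is the poset of irreducible closed subsets of $X$, ordered by inclusion (well-founded when $X$ is Noetherian). The sobrification rank of a Noetherian space $X$ is $\mathrm{sob}\, X = |\mathcal{S} X|$. *)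

(* Defs.v *)
From HB Require Import structures.
From mathcomp Require Import all_boot all_order.
From mathcomp Require Import finmap.
From mathcomp Require Import boolp classical_sets.
From mathcomp Require Import topology_structure compact.

Set Implicit Arguments.
Unset Strict Implicit.
Unset Printing Implicit Defensive.

Import Order.TTheory.
Local Open Scope classical_set_scope.

(* [osup f] denotes the ordinal sup_i (f i + 1).  Every ordinal is of this form,
   being the supremum of a' + 1 over all a' < a, but the presentation is not
   unique: equality of ordinals is [oeq], not [=]. *)
Inductive Ord : Type := osup (A : Type) (f : A -> Ord).

(* sup_i (f i + 1) <= sup_j (g j + 1) iff every f i is < sup_j (g j + 1),
   i.e., iff every f i is <= some g j. *)
Fixpoint ole (a b : Ord) : Prop :=
  match a, b with
  | osup A f, osup B g => forall i : A, exists j : B, ole (f i) (g j)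
  end.

Definition oeq (a b : Ord) : Prop := ole a b /\ ole b a.

Definition olt (a b : Ord) : Prop :=
  match b with osup B g => exists j : B, ole a (g j) end.

Definition ozero : Ord := osup (fun i : False => match i with end).

Definition osucc (a : Ord) : Ord := osup (fun _ : unit => a).

(* a + b = max (a, sup_{b' < b} (a + b' + 1)); see [oadd0], [oaddS] and
   [oadd_limit] for the usual recursion equations. *)
Fixpoint oadd (a b : Ord) : Ord :=
  match a, b with
  | osup A f, osup B g =>
      osup (fun k : A + B =>
        match k with inl i => f i | inr j => oadd a (g j) end)
  end.

Lemma ole_refl a : ole a a.
Proof. by elim: a => A f IH /= i; exists i. Qed.

Lemma ole_trans b a c : ole a b -> ole b c -> ole a c.
Proof.
elim: b a c => B g IH [A f] [C h] /= ab bc i.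
have [j fg] := ab i; have [k gh] := bc j.
by exists k; exact: IH fg gh.
Qed.

Lemma ole_total a b : ole a b \/ olt b a.
Proof.
elim: a b => A f IH [B g].
have [lefg|/existsNP[i] /forallNP fig] := pselect (ole (osup f) (osup g)).
  by left.
right; exists i.
case E : (f i) => [C h] j; have [/fig//|] := IH i (g j).
by rewrite E.
Qed.

Lemma ole_osupE (A : Type) (f : A -> Ord) b :
  ole (osup f) b <-> forall i, olt (f i) b.
Proof. by case: b. Qed.

Lemma olt_osup (A : Type) (f : A -> Ord) i : olt (f i) (osup f).
Proof. by exists i; exact: ole_refl. Qed.

Lemma olt_succE a b : olt a b <-> ole (osucc a) b.
Proof. by case: b => B g; split=> [ab []|/(_ tt)]. Qed.

Lemma olt_le_trans b a c : olt a b -> ole b c -> olt a c.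
Proof. by rewrite !olt_succE; exact: ole_trans. Qed.

Lemma ole_lt_trans b a c : ole a b -> olt b c -> olt a c.
Proof.
by case: c => C h ab [k bh]; exists k; exact: ole_trans ab bh.
Qed.

Lemma olt_le a b : olt a b -> ole a b.
Proof.
elim: b a => B g IH [A f] /= [j afg] i; exists j; apply: IH.
exact: olt_le_trans (olt_osup f i) afg.
Qed.

Lemma ole_addr a b : ole a (oadd a b).
Proof. by case: a b => A f [B g] i; exists (inl i); exact: ole_refl. Qed.

Lemma oadd0 a : oeq (oadd a ozero) a.
Proof.
split; last exact: ole_addr.
by case: a => A f; case=> // i; exists i; exact: ole_refl.
Qed.

Lemma oaddS a b : oeq (oadd a (osucc b)) (osucc (oadd a b)).
Proof.
split; last by case: a => A f []; exists (inr tt); exact: ole_refl.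
case: a => A f; case=> [i|[]]; exists tt; last exact: ole_refl.
exact/olt_le/(olt_le_trans (olt_osup f i))/ole_addr.
Qed.

Lemma olt_add2l a b b' : olt b' b -> olt (oadd a b') (oadd a b).
Proof.
elim: b b' => B g IH b' [j bj].
suff h : ole (oadd a b') (oadd a (g j)).
  by case: a IH h => A f IH h; exists (inr j).
case: b' bj => B' g' bj.
have b'j k : olt (g' k) (g j) := olt_le_trans (olt_osup g' k) bj.
have lej k : olt (oadd a (g' k)) (oadd a (g j)) := IH j _ (b'j k).
case: a {IH} lej => A f lej; apply/ole_osupE => -[i|k]; last exact: lej.
exact: olt_le_trans (olt_osup f i) (ole_addr _ _).
Qed.

Lemma oadd_limit a b c : olt ozero b ->
  (forall b', olt b' b -> olt (osucc b') b) ->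
  (forall b', olt b' b -> ole (oadd a b') c) -> ole (oadd a b) c.
Proof.
case: b => B g [j0 _] lim ub.
have agc j : olt (oadd a (g j)) c.
  apply/olt_succE/(ole_trans _ (ub _ (lim _ (olt_osup g j)))).
  by case: (oaddS a (g j)).
case: a {ub} agc => A f agc; apply/ole_osupE => -[i|//].
apply: ole_lt_trans (agc j0); apply: olt_le.
exact: olt_le_trans (olt_osup f i) (ole_addr _ _).
Qed.

Section Rank.
Context (d : Order.disp_t) (P : porderType d).
Hypothesis wfP : well_founded (fun x y : P => (x < y)%O).

Definition rk : P -> Ord :=
  Fix wfP (fun _ => Ord)
    (fun x rec => osup (fun y : {x' : P | (x' < x)%O} => rec (sval y) (svalP y))).

Lemma rkE x : rk x = osup (fun y : {x' : P | (x' < x)%O} => rk (sval y)).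
Proof.
rewrite /rk Fix_eq// => {}x u v uv; congr osup.
by apply: funext => y; exact: uv.
Qed.

Definition poset_rank : Ord := osup rk.

End Rank.

Definition noetherian (X : topologicalType) : Prop :=
  forall U : set X, open U -> cover_compact U.

Definition irreducible_closed (X : topologicalType) (C : set X) : Prop :=
  [/\ closed C, C !=set0 &
    forall F1 F2 : set X, closed F1 -> closed F2 ->
      C `<=` F1 `|` F2 -> C `<=` F1 \/ C `<=` F2].

(* The order is inherited from the inclusion order of [set X]. *)
Definition irrClosed (X : topologicalType) : Type :=
  {C : set X | `[< irreducible_closed C >]}.

HB.instance Definition _ (X : topologicalType) :=
  SubChoice.copy (irrClosed X) {C : set X | `[< irreducible_closed C >]}.
HB.instance Definition _ (X : topologicalType) :=
  [SubChoice_isSubPOrder of irrClosed X by <: with set_display].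

Lemma irrClosed_ltE (X : topologicalType) (C D : irrClosed X) :
  (C < D)%O <-> val C `<` val D.
Proof. by rewrite -properEset. Qed.

Lemma noetherian_wf (X : topologicalType) : noetherian X ->
  well_founded (fun C D : irrClosed X => (C < D)%O).
Proof.
move=> nX C; apply: contrapT => nC.
pose T := {D : irrClosed X | ~ Acc (fun C D : irrClosed X => (C < D)%O) D}.
have step (D : T) : exists E : T, (sval E < sval D)%O.
  case: D => D nD; apply: contrapT => nE; apply: (nD); constructor=> E ED.
  by apply: contrapT => nAE; apply: nE; exists (exist _ E nAE).
have [next nextP] := choice step.
pose f n := val (sval (iter n next (exist _ C nC : T))).
have fS n : f n.+1 `<` f n by apply/irrClosed_ltE; exact: nextP.
have fle m n : m <= n -> f n `<=` f m.
  elim: n => [|n IH]; first by rewrite leqn0 => /eqP->.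
  rewrite leq_eqVlt => /predU1P[->//|/IH]; apply: subset_trans.
  exact: properW (fS n).
have fopen n : open (~` f n).
  apply: closed_openC.
  by have /asboolP[] := valP (sval (iter n next (exist _ C nC : T))).
have opU : open (\bigcup_n ~` f n) by exact: bigcup_open.
have [D' _ cov] := nX _ opU nat setT (fun n => ~` f n) (fun n _ => fopen n)
  (@subset_refl _ _).
pose N := \max_(n <- enum_fset D') n.
have [_ /existsNP[x]] := fS N; case/not_implyP=> fNx nfx.
have [|n /= nD' nfn] := cov x; first by exists N.+1.
by apply: nfn; apply: fle fNx; exact: leq_bigmax_seq.
Qed.

Definition sob (X : topologicalType) (nX : noetherian X) : Ord :=
  poset_rank (noetherian_wf nX).

Definition lexsum (X Y : Type) : Type := (X + Y)%type.

HB.instance Definition _ (X Y : choiceType) :=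
  Choice.copy (lexsum X Y) (X + Y)%type.

Section LexSum.
Context (X Y : topologicalType).

Definition lexsum_open (W : set (lexsum X Y)) : Prop :=
  (exists2 V : set Y, open V & W = inr @` V) \/
  (exists2 U : set X, open U & W = inl @` U `|` range inr).

Lemma lexsum_openE W : lexsum_open W <->
  [/\ open (inl @^-1` W : set X), open (inr @^-1` W : set Y) &
      inl @^-1` W !=set0 -> range inr `<=` W].
Proof.
split=> [[[V oV ->]|[U oU ->]]|[oU oV UV]].
- split; last by case=> x [].
    rewrite [X in open X](_ : _ = set0); first exact: open0.
    by apply/seteqP; split=> // x [].
  rewrite [X in open X](_ : _ = V)//; apply/seteqP; split=> y /=.
    by case=> z Vz [<-].
  by exists y.
- split; last by move=> _ z ?; right.
    rewrite [X in open X](_ : _ = U)//; apply/seteqP; split=> x /=.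
      by case=> -[]// z Uz [<-].
    by left; exists x.
  rewrite [X in open X](_ : _ = setT); first exact: openT.
  by apply/seteqP; split=> // y _; right; exists y.
- have [U0|/eqP/set0P Un0] := pselect (inl @^-1` W = set0).
    left; exists (inr @^-1` W) => //; apply/seteqP; split=> [[x|y] Wz|_ [y Wy <-]//].
      by have : (inl @^-1` W) x by []; rewrite U0.
    by exists y.
  right; exists (inl @^-1` W) => //; apply/seteqP; split=> [[x|y] Wz|z].
  - by left; exists x.
  - by right; exists y.
  - by case=> [[x Wx <-]//|]; exact: UV.
Qed.

Lemma lexsum_openT : lexsum_open setT.
Proof. by apply/lexsum_openE; split=> //; rewrite preimage_setT; exact: openT. Qed.

Lemma lexsum_openI : setI_closed lexsum_open.
Proof.
move=> A B /lexsum_openE[oA1 oA2 A12] /lexsum_openE[oB1 oB2 B12].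
apply/lexsum_openE; rewrite !preimage_setI; split; [exact: openI..|].
by case=> x [Ax Bx] z rz; split; [apply: A12|apply: B12] => //; exists x.
Qed.

Lemma lexsum_open_bigcup (I : Type) (f : I -> set (lexsum X Y)) :
  (forall i, lexsum_open (f i)) -> lexsum_open (\bigcup_i f i).
Proof.
move=> fo; have {}fo i := (lexsum_openE (f i)).1 (fo i).
apply/lexsum_openE; rewrite !preimage_bigcup; split.
- by apply: bigcup_open => i _; case: (fo i).
- by apply: bigcup_open => i _; case: (fo i).
- case=> x [i _ fix_] z rz; exists i => //; case: (fo i) => _ _; apply=> //.
  by exists x.
Qed.

HB.instance Definition _ := isOpenTopological.Build (lexsum X Y)
  lexsum_openT lexsum_openI lexsum_open_bigcup.

Lemma open_lexsumE : (open : set_system (lexsum X Y)) = lexsum_open.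
Proof. by []. Qed.

Lemma lexsum_noetherian :
  noetherian X -> noetherian Y -> noetherian (lexsum X Y).
Proof.
move=> nX nY W; rewrite open_lexsumE => /lexsum_openE[oU oV _] I D f fo Wf.
have {}fo i (Di : D i) := (lexsum_openE (f i)).1 (fo i Di).
have [|x Wx|D1 D1D cov1] := nX _ oU I D (fun i => inl @^-1` f i).
- by move=> i /fo[].
- by have [i Di fix_] := Wf _ Wx; exists i.
have [|y Wy|D2 D2D cov2] := nY _ oV I D (fun i => inr @^-1` f i).
- by move=> i /fo[].
- by have [i Di fiy] := Wf _ Wy; exists i.
exists (D1 `|` D2)%fset.
  by move=> i; rewrite in_fsetU => /orP[/D1D|/D2D].
move=> [x|y] Wz.
- have [i /= D1i fix_] := cov1 _ Wz; exists i => //=.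
  by rewrite in_fsetU D1i.
- have [i /= D2i fiy] := cov2 _ Wz; exists i => //=.
  by rewrite in_fsetU D2i orbT.
Qed.

End LexSum.

(* Main.v *)
From mathcomp Require Import all_boot all_order.
From mathcomp Require Import boolp classical_sets.
Require Import Defs.
From mathcomp Require Import topology_structure.

(** A closed subset of the lexicographic sum either misses [Y] and is a closed
    subset of [X], or meets [Y] and then contains the whole of [X], because a
    nonempty open trace on [X] forces an open set to contain [Y]
    ([lexsum_closedE]).  Hence its irreducible closed subsets are those of [X]
    ([below]) together with the sets [X + D], [D] irreducible closed in [Y]
    ([above]), and there are no others ([below_or_above]): the poset of
    irreducible closed subsets of the sum is that of [X] with that of [Y] put
    on top of it.

    The rank of such an ordinal sum of posets is the sum of the ranks
    ([poset_rank_sum]).  The elements of the lower part [P] keep their rank,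
    and below an element [q] of the upper part lie all of [P] and the elements
    of the upper part below [q], so that its rank is [|P|] plus the rank of [q]:
    this is exactly the recursion by which [oadd] is defined. *)

Set Implicit Arguments.
Unset Strict Implicit.
Unset Printing Implicit Defensive.

Import Order.TTheory.
Local Open Scope classical_set_scope.

Section OrdinalSum.
Context (dP dQ dS : Order.disp_t).
Context (P : porderType dP) (Q : porderType dQ) (S : porderType dS).
Hypothesis wfP : well_founded (fun x y : P => (x < y)%O).
Hypothesis wfQ : well_founded (fun x y : Q => (x < y)%O).
Hypothesis wfS : well_founded (fun x y : S => (x < y)%O).
Context (f : P -> S) (g : Q -> S).
Hypothesis f_lt : {mono f : x y / (x < y)%O}.
Hypothesis g_lt : {mono g : x y / (x < y)%O}.
Hypothesis fg_lt : forall p q, (f p < g q)%O.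
Hypothesis fg_cover : forall s, (exists p, s = f p) \/ (exists q, s = g q).

Lemma rk_lower p : oeq (rk wfS (f p)) (rk wfP p).
Proof.
elim/(well_founded_ind wfP): p => p IH; rewrite !rkE; split.
  move=> [s /= s_lt]; have [[p' sE]|[q sE]] := fg_cover s; subst s.
    by move: (s_lt); rewrite f_lt => lt_p; exists (exist _ p' lt_p);
       case: (IH _ lt_p).
  by have := lt_trans s_lt (fg_lt p q); rewrite ltxx.
move=> [p' /= lt_p]; have lt_f : (f p' < f p)%O by rewrite f_lt.
by exists (exist _ (f p') lt_f); case: (IH _ lt_p).
Qed.

(** By induction on [q]: the elements below [g q] are the [f p], whose ranks are
    cofinal in [|P|], and the [g q'] with [q' < q], which contribute
    [|P| + rk q'] each. *)
Lemma rk_upper q : oeq (rk wfS (g q)) (oadd (poset_rank wfP) (rk wfQ q)).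
Proof.
elim/(well_founded_ind wfQ): q => q IH; rewrite !rkE; split.
  move=> [s /= s_lt]; have [[p sE]|[q' sE]] := fg_cover s; subst s.
    by exists (inl p); case: (rk_lower p).
  move: (s_lt); rewrite g_lt => lt_q.
  by exists (inr (exist _ q' lt_q)); case: (IH _ lt_q).
move=> [p|[q' /= lt_q]].
  by exists (exist _ (f p) (fg_lt p q)); case: (rk_lower p).
have lt_g : (g q' < g q)%O by rewrite g_lt.
by exists (exist _ (g q') lt_g); case: (IH _ lt_q).
Qed.

Lemma poset_rank_sum :
  oeq (poset_rank wfS) (oadd (poset_rank wfP) (poset_rank wfQ)).
Proof.
split.
  move=> s; have [[p ->]|[q ->]] := fg_cover s.
    by exists (inl p); case: (rk_lower p).
  by exists (inr q); case: (rk_upper q).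
move=> [p|q].
  by exists (f p); case: (rk_lower p).
by exists (g q); case: (rk_upper q).
Qed.

End OrdinalSum.

Section LexSumIrreducible.
Context (X Y : topologicalType).
Implicit Types (C : set X) (D : set Y) (W : set (lexsum X Y)).

(** Complementing [lexsum_openE] reverses the roles of the two summands: it is
    now a point of [Y] that forces all of [X] into the set. *)
Lemma lexsum_closedE W : closed W <->
  [/\ closed (inl @^-1` W : set X), closed (inr @^-1` W : set Y) &
      inr @^-1` W !=set0 -> forall x, W (inl x)].
Proof.
rewrite -openC open_lexsumE; split.
  move=> /lexsum_openE[oX oY XY]; split; [by rewrite -openC..|].
  move=> [y Wy] x; apply: contrapT => nWx.
  by apply: (XY _ (inr y)) Wy; [exists x|exists y].
move=> [cX cY XY]; apply/lexsum_openE; split; [exact: closed_openC..|].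
by move=> [x nWx] _ [y _ <-] Wy; apply: nWx; apply: XY; exists y.
Qed.

(** [below_set] and [above_set] are defined by cases rather than as unions of
    images so that their traces on [X] and [Y] hold by computation. *)
Definition below_set C : set (lexsum X Y) :=
  fun z => match z with inl x => C x | inr _ => False end.

Definition above_set D : set (lexsum X Y) :=
  fun z => match z with inl _ => True | inr y => D y end.

Lemma closed_below_set C : closed C -> closed (below_set C).
Proof.
by move=> cC; apply/lexsum_closedE; split=> //; [exact: closed0|case].
Qed.

Lemma closed_above_set D : closed D -> closed (above_set D).
Proof. by move=> cD; apply/lexsum_closedE; split=> //; exact: closedT. Qed.

Lemma irreducible_below_set C :
  irreducible_closed C -> irreducible_closed (below_set C).
Proof.
move=> [cC [x Cx] irrC]; split; [exact: closed_below_set|by exists (inl x)|].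
move=> F1 F2 /lexsum_closedE[cF1 _ _] /lexsum_closedE[cF2 _ _] CF.
have [|CF1|CF2] := irrC _ _ cF1 cF2; first by move=> z Cz; exact: (CF (inl z)).
- by left=> -[z /CF1|].
- by right=> -[z /CF2|].
Qed.

(** A closed set that contains the nonempty [D] also contains [X], so only the
    traces on [Y] of a covering of [X + D] matter. *)
Lemma irreducible_above_set D :
  irreducible_closed D -> irreducible_closed (above_set D).
Proof.
move=> [cD [y Dy] irrD]; split; [exact: closed_above_set|by exists (inr y)|].
move=> F1 F2 /lexsum_closedE[_ cF1 XF1] /lexsum_closedE[_ cF2 XF2] DF.
have [|DF1|DF2] := irrD _ _ cF1 cF2; first by move=> z Dz; exact: (DF (inr z)).
- by left=> -[x _|z /DF1//]; apply: XF1; exists y; exact: DF1.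
- by right=> -[x _|z /DF2//]; apply: XF2; exists y; exact: DF2.
Qed.

Lemma irreducible_of_below_set C :
  irreducible_closed (below_set C) -> irreducible_closed C.
Proof.
move=> [/lexsum_closedE[cC _ _] [[x|y] // Cx] irrC].
split=> //; first by exists x.
move=> F1 F2 cF1 cF2 CF.
have [|CF1|CF2] := irrC _ _ (closed_below_set cF1) (closed_below_set cF2).
- by move=> [z /CF|].
- by left=> z Cz; exact: (CF1 (inl z)).
- by right=> z Cz; exact: (CF2 (inl z)).
Qed.

Lemma irreducible_of_above_set D : D !=set0 ->
  irreducible_closed (above_set D) -> irreducible_closed D.
Proof.
move=> D0 [/lexsum_closedE[_ cD _] _ irrD]; split=> // F1 F2 cF1 cF2 DF.
have [|DF1|DF2] := irrD _ _ (closed_above_set cF1) (closed_above_set cF2).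
- by move=> [z _|z /DF//]; left.
- by left=> z Dz; exact: (DF1 (inr z)).
- by right=> z Dz; exact: (DF2 (inr z)).
Qed.

Lemma irrClosedP (T : topologicalType) (C : irrClosed T) :
  irreducible_closed (val C).
Proof. by case: C => C /= /asboolP. Qed.

Definition below (C : irrClosed X) : irrClosed (lexsum X Y) :=
  exist _ (below_set (val C)) (asboolT (irreducible_below_set (irrClosedP C))).

Definition above (D : irrClosed Y) : irrClosed (lexsum X Y) :=
  exist _ (above_set (val D)) (asboolT (irreducible_above_set (irrClosedP D))).

Lemma below_set_subset C C' : below_set C `<=` below_set C' <-> C `<=` C'.
Proof. by split=> [CC x|CC [x|//]]; [exact: (CC (inl x))|exact: CC]. Qed.

Lemma above_set_subset D D' : above_set D `<=` above_set D' <-> D `<=` D'.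
Proof. by split=> [DD y|DD [//|y]]; [exact: (DD (inr y))|exact: DD]. Qed.

Lemma below_lt : {mono below : C C' / (C < C')%O}.
Proof.
move=> C C'; apply/idP/idP => /irrClosed_ltE[sub nsub]; apply/irrClosed_ltE.
  by split; [exact/below_set_subset|move=> /below_set_subset].
by split; [exact/below_set_subset|move=> /below_set_subset].
Qed.

Lemma above_lt : {mono above : D D' / (D < D')%O}.
Proof.
move=> D D'; apply/idP/idP => /irrClosed_ltE[sub nsub]; apply/irrClosed_ltE.
  by split; [exact/above_set_subset|move=> /above_set_subset].
by split; [exact/above_set_subset|move=> /above_set_subset].
Qed.

Lemma below_above_lt (C : irrClosed X) (D : irrClosed Y) : (below C < above D)%O.
Proof.
apply/irrClosed_ltE; split; first by case.
by have [_ [y Dy] _] := irrClosedP D; move=> /(_ (inr y) Dy).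
Qed.

(** Whether [W] meets [Y] decides the case.  If it does not, nothing forces
    [X] into [W], which is then a closed subset of [X]; in particular [X]
    itself, when irreducible, counts as coming from [X] and not as [X] plus the
    empty set. *)
Lemma below_or_above (W : irrClosed (lexsum X Y)) :
  (exists C : irrClosed X, W = below C) \/
  (exists D : irrClosed Y, W = above D).
Proof.
have irrW := irrClosedP W; have [/lexsum_closedE[_ _ XW] _ _] := irrW.
have [W0|nW0] := pselect (inr @^-1` val W !=set0).
  have WE : val W = above_set (inr @^-1` val W).
    by apply/seteqP; split=> -[x|y]// _; exact: XW.
  right; rewrite WE in irrW.
  pose D : irrClosed Y :=
    exist _ (inr @^-1` val W) (asboolT (irreducible_of_above_set W0 irrW)).
  by exists D; exact: val_inj.
have WE : val W = below_set (inl @^-1` val W).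
  by apply/seteqP; split=> -[x|y]//= Wy; apply: nW0; exists y.
left; rewrite WE in irrW.
pose C : irrClosed X :=
  exist _ (inl @^-1` val W) (asboolT (irreducible_of_below_set irrW)).
by exists C; exact: val_inj.
Qed.

End LexSumIrreducible.

Theorem proposition9p4 (X Y : topologicalType)
    (nX : noetherian X) (nY : noetherian Y) :
  oeq (sob (lexsum_noetherian nX nY)) (oadd (sob nX) (sob nY)).
Proof.
exact: poset_rank_sum (@below_lt X Y) (@above_lt X Y)
  (@below_above_lt X Y) (@below_or_above X Y).
Qed.
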